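(* Let $n$ be a positive integer, and let $m_1,\dots,m_{n+1}\in\mathbb R$ satisfy $\prod_{j=1}^{n+1}m_j\ne0$ and $\sum_{j=1}^{n+1}m_j\ne0$. Let $z_1,\dots,z_{n+1}\in\mathbb T=\{z\in\mathbb C:|z|=1\}$ be distinct, and let $a_1,\dots,a_n$ denote the zeros (counted with multiplicity) of the partial fraction $$F(z)=\sum_{j=1}^{n+1}\frac{m_j}{z-z_j}.$$ Then there exists $\lambda\in\mathbb T$ such that, for every $r=1,\dots,n+1$, $$e_r(z_1,\dots,z_{n+1})=e_r(a_1,\dots,a_n)+(-1)^n\,e_{n+1-r}(\overline{a_1},\dots,\overline{a_n})\,\lambda.$$
   Context: $e_r(x_1,\dots,x_n)$ denotes the $r$th elementary symmetric polynomial in $x_1,\dots,x_n$, with the conventions $e_0=1$ and $e_r(x_1,\dots,x_n)=0$ for $r>n$. *)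

(* Defs.v *)
From HB Require Import structures.
From mathcomp Require Import all_boot all_order all_algebra.
From mathcomp Require Import reals.
From mathcomp Require Import complex mpoly.

Set Implicit Arguments.
Unset Strict Implicit.
Unset Printing Implicit Defensive.

Import Order.TTheory GRing.Theory Num.Theory.
Local Open Scope ring_scope.

(* Since mesym sums over the r-subsets of 'I_n, this is 1 for r = 0 and 0 for
   r > n. *)
Definition elem_sym (K : comNzRingType) (n : nat) (x : 'I_n -> K) (r : nat) : K :=
  (mesym n K r).@[x].

Definition ratfun (K : fieldType) := {fraction {poly K}}.

Definition partial_fraction (K : fieldType) (n : nat) (m z : 'I_n -> K) :
    ratfun K :=
  \sum_(j < n) tofrac (m j)%:P / tofrac ('X - (z j)%:P).

(* f = (X - w)^k g, where the rational function g is defined and nonzero at w.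
   No k satisfies this when w is a pole of f. *)
Definition zero_of_order (K : fieldType) (f : ratfun K) (w : K) (k : nat) :
    Prop :=
  exists p q : {poly K},
    [/\ p.[w] != 0, q.[w] != 0 &
        f = tofrac (('X - w%:P) ^+ k) * (tofrac p / tofrac q)].

(* The restriction 0 < k leaves count 0 for both the regular nonzeros and the
   poles of f. *)
Definition zeros_with_multiplicity (K : fieldType) (n : nat) (f : ratfun K)
    (a : 'I_n -> K) : Prop :=
  forall (w : K) (k : nat), (0 < k)%N ->
    (zero_of_order f w k <-> #|[set i | a i == w]| = k).

(* Main.v *)
Require Import Defs.
From HB Require Import structures.
From mathcomp Require Import all_boot all_order all_algebra.
From mathcomp Require Import reals.
From mathcomp Require Import complex.
From mathcomp Require mpoly.
From mathcomp Require Import ring.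

Set Implicit Arguments.
Unset Strict Implicit.
Unset Printing Implicit Defensive.

Import Order.TTheory GRing.Theory Num.Theory.
Local Open Scope ring_scope.

(* Let P be the product of the X - z_j, Q the product of the X - a_i, M the sum
   of the m_j, and Q^*(X) = X^n conj(Q(1 / conj X)). The numerator of F is M Q,
   so M Q(z_k) = m_k P'(z_k). As M and the m_k are real and the z_j are on the
   unit circle, conjugating gives z_k Q(z_k) = lambda Q^*(z_k) for all k, where
   lambda = (-1)^n z_1 ... z_{n+1}. Hence P and X Q - lambda Q^*, both monic of
   degree n + 1 and vanishing at every z_k, are equal: compare coefficients. *)

Lemma elem_sym_gt (K : comNzRingType) n (x : 'I_n -> K) r :
  (n < r)%N -> elem_sym x r = 0.
Proof. by move=> n_lt_r; rewrite /elem_sym mpoly.mesym_geqnE // mpoly.meval0. Qed.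

Lemma coef_prod_XsubC_elem_sym (K : idomainType) n (x : 'I_n -> K) r :
  (r <= n)%N ->
  (\prod_(i < n) ('X - (x i)%:P))`_(n - r) = (-1) ^+ r * elem_sym x r.
Proof.
move=> r_le_n.
have r_lt : (r < n.+1)%N by [].
have := mpoly.mroots_coeff [tuple x i | i < n] (Ordinal r_lt).
rewrite big_map big_enum /= => ->; congr (_ * _).
by apply: mpoly.meval_eq => i; rewrite tnth_mktuple.
Qed.

Definition pf_numer (K : fieldType) n (m z : 'I_n -> K) : {poly K} :=
  \sum_(j < n) (m j)%:P * \prod_(i < n | i != j) ('X - (z i)%:P).

Section Numerator.
Variables (K : fieldType) (n : nat) (m z : 'I_n -> K).

Lemma partial_fractionE :
  partial_fraction m z =
    tofrac (pf_numer m z) / tofrac (\prod_(i < n) ('X - (z i)%:P)).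
Proof.
rewrite /partial_fraction rmorph_sum mulr_suml; apply: eq_bigr => j _.
set P := \prod_(i < n | i != j) _.
have P_neq0 : P != 0 by apply/prodf_neq0 => i _; rewrite polyXsubC_eq0.
have -> : \prod_(i < n) ('X - (z i)%:P) = ('X - (z j)%:P) * P.
  by rewrite (bigD1 j).
by rewrite /= !tofracM -mulf_div divff ?mulr1 // tofrac_eq0.
Qed.

(** Every summand with index other than [k] contains the factor ['X - z k]. The product that
    survives is the derivative of the common denominator at [z k]. *)
Lemma horner_pf_numer k :
  (pf_numer m z).[z k] = m k * \prod_(i < n | i != k) (z k - z i).
Proof.
rewrite horner_sum (bigD1 k) //= [X in _ + X]big1 ?addr0 => [|j jk].
  rewrite hornerM hornerC horner_prod; congr (_ * _).
  by apply: eq_bigr => i _; rewrite hornerXsubC.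
rewrite hornerM horner_prod (bigD1 k) 1?eq_sym //=.
by rewrite hornerXsubC subrr mul0r mulr0.
Qed.

End Numerator.

Lemma coef_pf_numer (K : fieldType) n (m z : 'I_n.+1 -> K) :
  (pf_numer m z)`_n = \sum_j m j.
Proof.
rewrite coef_sum; apply: eq_bigr => j _; rewrite coefCM.
have /monicP := monic_prod_XsubC (index_enum 'I_n.+1) (fun i => i != j) z.
rewrite lead_coefE -big_filter size_prod_XsubC /=.
suff -> : size [seq i <- index_enum 'I_n.+1 | i != j] = n by move->; rewrite mulr1.
by rewrite -sum1_size big_filter sum1_card cardC1 card_ord.
Qed.

(* As the m j and the differences of the z j are nonzero, the numerator of the
   partial fraction does not vanish at the z j, so its roots are the zeros. *)
Lemma pf_numer_zeros (K : closedFieldType) n (m z : 'I_n.+1 -> K)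
    (a : 'I_n -> K) :
  injective z -> (forall j, m j != 0) ->
  zeros_with_multiplicity (partial_fraction m z) a ->
  pf_numer m z = (\sum_j m j) *: \prod_(i < n) ('X - (a i)%:P).
Proof.
move=> z_inj m_neq0 a_zeros; set N := pf_numer m z.
pose P : {poly K} := \prod_(i < n.+1) ('X - (z i)%:P).
have P_neq0 : P != 0 by apply/prodf_neq0 => i _; rewrite polyXsubC_eq0.
have Nz k : N.[z k] != 0.
  rewrite horner_pf_numer mulf_neq0 //; apply/prodf_neq0 => i ik.
  by rewrite subr_eq0 (inj_eq z_inj) eq_sym.
have N_neq0 : N != 0.
  by apply: contraNneq (Nz ord0) => ->; rewrite horner0.
have FE := partial_fractionE m z; rewrite -/N -/P in FE.
have [bs Nbs] := closed_field_poly_normal N.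
have lN : lead_coef N != 0 by rewrite lead_coef_eq0.
have rootN w : root N w = (w \in bs).
  by rewrite Nbs rootZ // root_prod_XsubC.
have perm : perm_eq bs (codom a).
  apply/allP => w _ /=; apply/eqP.
  have -> : count_mem w (codom a) = #|[set i | a i == w]|.
    rewrite -sum1_card -sum1_count big_map big_enum_cond.
    by apply: eq_bigl => i; rewrite !inE.
  (* The hypothesis on [a] only speaks of positive orders. If [w] is not in [bs] but occurs in [a],
     the partial fraction has a zero of positive order at [w]; cross-multiplying and evaluating at
     [w] gives N(w) q(w) = 0, a contradiction. *)
  have [k0|k_gt0] := posnP (count_mem w bs).
    rewrite k0; apply/esym/eqP; case: posnP => // c_gt0.
    have [_ /(_ erefl)] := a_zeros w _ c_gt0.
    move=> [p [q [pw qw]]]; rewrite FE => /eqP.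
    have q_neq0 : q != 0 by apply: contraNneq qw => ->; rewrite horner0.
    rewrite mulrA -tofracM eqr_div ?tofrac_eq0 // -!tofracM tofrac_eq => /eqP.
    move=> /(congr1 (fun r => r.[w])); rewrite !hornerM horner_exp hornerXsubC.
    rewrite subrr expr0n gtn_eqF // !mul0r => /eqP.
    rewrite mulf_eq0 (negPf qw) orbF -/(root N w) rootN -has_pred1 has_count.
    by rewrite k0.
  apply/esym/(a_zeros w _ k_gt0).
  (* The first witness is [N] stripped of its factors ['X - w%:P]. [P] does not vanish at [w], since
     [w] is a root of [N] and no [z k] is. *)
  exists (lead_coef N *: \prod_(x <- bs | x != w) ('X - x%:P)), P.
  have wbs : w \in bs by rewrite -has_pred1 has_count.
  split.
  - rewrite hornerZ mulf_neq0 // horner_prod prodf_seq_neq0.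
    by apply/allP => x _; rewrite hornerXsubC subr_eq0 eq_sym implybb.
  - rewrite horner_prod; apply/prodf_neq0 => i _.
    rewrite hornerXsubC subr_eq0; apply: contraTneq wbs => ->.
    by rewrite -rootN; apply: Nz.
  - rewrite mulrA -tofracM FE -scalerAr; congr (tofrac _ / _).
    rewrite [LHS]Nbs (bigID (pred1 w)) /=; congr (_ *: (_ * _)).
    rewrite (eq_bigr (fun=> 'X - w%:P)) => [|x /eqP -> //].
    by rewrite big_const_seq iter_mulr_1.
have size_bs : size bs = n.
  by rewrite (perm_size perm) size_codom card_ord.
rewrite [LHS]Nbs; congr (_ *: _).
  (* Counting the zeros has fixed the degree of [N] at [n], so its leading coefficient is the one
     given by [coef_pf_numer]. *)
  have size_N : size N = n.+1.
    by rewrite Nbs size_scale // size_prod_XsubC size_bs.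
  by rewrite -(coef_pf_numer m z) -/N lead_coefE size_N.
by rewrite (perm_big _ perm) /= big_map big_enum.
Qed.

Lemma circle_conj (C : numClosedFieldType) (u : C) : `|u| = 1 -> u^* = u^-1.
Proof. by move=> u1; rewrite invC_norm u1 expr1n invr1 mul1r. Qed.

(* On the unit circle [(u - v)^* = - (u - v) / (u * v)]. *)
Lemma conj_prod_circle_sub (C : numClosedFieldType) n (z : 'I_n.+1 -> C) k :
  (forall j, `|z j| = 1) ->
  z k ^+ n * (\prod_(i < n.+1 | i != k) (z k - z i))^*
    * ((-1) ^+ n * \prod_j z j) = z k * \prod_(i < n.+1 | i != k) (z k - z i).
Proof.
move=> z1; have z_neq0 j : z j != 0 by rewrite -normr_eq0 z1 oner_eq0.
have prodr_const_n (c : C) : \prod_(i < n.+1 | i != k) c = c ^+ n.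
  by rewrite prodr_const cardC1 card_ord.
rewrite [\prod_j z j](bigD1 k) //= rmorph_prod -!prodr_const_n.
rewrite [RHS]mulrC.
(* Spread the [n] copies of [z k] and of -1 over the [n] factors; the identity then holds factor by
   factor. *)
rewrite [LHS](_ : _ = \prod_(i < n.+1 | i != k)
   (z k * (z k - z i)^* * -1 * z i) * z k); last first.
  by rewrite !big_split /=; ring.
congr (_ * _); apply: eq_bigr => i _.
by rewrite rmorphB /= !circle_conj //; field; rewrite !z_neq0.
Qed.

(* [reciprocal_poly a] is [X^n * conj (Q (1 / conj X))] for
   [Q = \prod_i ('X - a i)]. *)
Definition reciprocal_poly (C : numClosedFieldType) n (a : 'I_n -> C) : {poly C} :=
  \poly_(k < n.+1) ((-1) ^+ k * elem_sym (fun i => (a i)^*) k).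

(** Conjugation inverts [u], so the conjugate of Q(u) is the polynomial with roots [(a i)^*]
    evaluated at [u^-1]; multiplying by [u ^+ n] reverses its coefficients. *)
Lemma horner_reciprocal_poly (C : numClosedFieldType) n (a : 'I_n -> C) u :
  `|u| = 1 ->
  (reciprocal_poly a).[u] =
    u ^+ n * ((\prod_(i < n) ('X - (a i)%:P)).[u])^*.
Proof.
move=> u1; have u_neq0 : u != 0 by rewrite -normr_eq0 u1 oner_eq0.
have -> : (\prod_(i < n) ('X - (a i)%:P)).[u]^* =
          (\prod_(i < n) ('X - ((a i)^*)%:P)).[u^-1].
  rewrite !horner_prod rmorph_prod; apply: eq_bigr => i _.
  by rewrite !hornerXsubC rmorphB /= circle_conj.
rewrite [in RHS](@horner_coef_wide _ n.+1); last first.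
  by rewrite size_prod_XsubC /index_enum -enumT size_enum_ord.
rewrite (reindex_inj rev_ord_inj) mulr_sumr /reciprocal_poly horner_poly.
apply: eq_bigr => k _; rewrite /= subSS.
have k_le_n : (k <= n)%N by rewrite -ltnS.
rewrite coef_prod_XsubC_elem_sym // mulrCA exprVn; congr (_ * _).
by rewrite -{2}(subnKC k_le_n) exprD mulfK // expf_neq0.
Qed.

Lemma elem_sym_circle (C : numClosedFieldType) n (m z : 'I_n.+1 -> C)
    (a : 'I_n -> C) :
  injective z -> (forall j, `|z j| = 1) ->
  (forall j, m j != 0) -> (forall j, (m j)^* = m j) -> \sum_j m j != 0 ->
  zeros_with_multiplicity (partial_fraction m z) a ->
  forall r, (1 <= r <= n.+1)%N ->
  elem_sym z r = elem_sym a r + (-1) ^+ n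
    * elem_sym (fun i => (a i)^*) (n.+1 - r) * ((-1) ^+ n * \prod_j z j).
Proof.
move=> z_inj z1 m_neq0 m_real M_neq0 a_zeros.
set M := \sum_j m j in M_neq0; set lambda := _ * \prod_j z j.
pose Q := \prod_(i < n) ('X - (a i)%:P).
have QE k : Q.[z k] = M^-1 * m k * \prod_(i < n.+1 | i != k) (z k - z i).
  rewrite -mulrA -horner_pf_numer (pf_numer_zeros z_inj m_neq0 a_zeros).
  by rewrite hornerZ mulKf.
have M_real : M^* = M by rewrite rmorph_sum; apply: eq_bigr => j _; apply: m_real.
have Q_size : size Q = n.+1.
  by rewrite size_prod_XsubC /index_enum -enumT size_enum_ord.
have Q_monic : Q \is monic by apply: monic_prod_XsubC.
pose G := 'X * Q - lambda *: reciprocal_poly a.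
have XQ_size : size ('X * Q) = n.+2.
  by rewrite mulrC size_mulX ?monic_neq0 // Q_size.
(* The reciprocal polynomial has degree at most [n], so [G] inherits its degree and leading
   coefficient from ['X * Q]. *)
have rec_size : (size (- (lambda *: reciprocal_poly a)) < size ('X * Q)%R)%N.
  by rewrite size_polyN XQ_size ltnS (leq_trans (size_scale_leq _ _)) ?size_poly.
have G_size : size G = n.+2 by rewrite size_polyDl.
have G_lead : lead_coef G = 1.
  by rewrite lead_coefDl // lead_coefM lead_coefX mul1r; apply/monicP.
have G_root k : root G (z k).
  rewrite rootE hornerD hornerN hornerZ hornerM hornerX.
  rewrite horner_reciprocal_poly // -/Q QE !rmorphM /= fmorphV /= M_real m_real.
  rewrite subr_eq0 [X in X == _]mulrCA -(conj_prod_circle_sub k z1) -/lambda.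
  by apply/eqP; ring.
have GE : G = \prod_(i < n.+1) ('X - (z i)%:P).
  rewrite (@all_roots_prod_XsubC _ G (codom z)).
  - by rewrite G_lead scale1r big_map big_enum.
  - by rewrite G_size size_codom card_ord.
  - by apply/allP => _ /codomP[k ->].
  - by rewrite uniq_rootsE; apply/injectiveP.
move=> r /andP[r_gt0 r_le].
(* Compare the coefficients of degree [n.+1 - r], which is at most [n] because [r] is positive. *)
apply: (mulfI (negbT (signr_eq0 _ r))).
rewrite -coef_prod_XsubC_elem_sym // -GE coefB coefXM coefZ coef_poly.
have -> : (n.+1 - r < n.+1)%N by rewrite ltn_subrL r_gt0.
(* For [r = n.+1] this is the zero constant term of ['X * Q], in agreement with the convention that
   [elem_sym a n.+1] vanishes. *)
have XQ_coef : (if (n.+1 - r == 0)%N then 0 else Q`_(n.+1 - r).-1)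
    = (-1) ^+ r * elem_sym a r.
  rewrite subn_eq0; case: ltnP => [n_lt_r | r_le_n].
    by rewrite elem_sym_gt ?mulr0.
  by rewrite subSn //= coef_prod_XsubC_elem_sym.
have sign : (-1) ^+ r * (-1) ^+ n = - (-1) ^+ (n.+1 - r) :> C.
  have -> : (-1) ^+ n = - (-1) ^+ (r + (n.+1 - r)) :> C.
    by rewrite subnKC // exprS mulN1r opprK.
  by rewrite exprD mulrN mulrA -expr2 sqrr_sign mul1r.
by rewrite XQ_coef [lambda * _]mulrC mulrDr !mulrA sign !mulNr.
Qed.

Theorem theorem3p4 (R : realType) (n : nat) (n_gt0 : (0 < n)%N)
  (m : 'I_n.+1 -> R)
  (m_prod : \prod_(j < n.+1) m j != 0)
  (m_sum : \sum_(j < n.+1) m j != 0)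
  (z : 'I_n.+1 -> R[i])
  (z_circle : forall j, `|z j| = 1)
  (z_inj : injective z)
  (a : 'I_n -> R[i])
  (a_zeros : zeros_with_multiplicity
               (partial_fraction (fun j => (m j)%:C%C) z) a) :
  exists lambda : R[i], `|lambda| = 1 /\
    forall r : nat, (1 <= r <= n.+1)%N ->
      elem_sym z r =
        elem_sym a r + (-1) ^+ n * elem_sym (fun i => (a i)^*) (n.+1 - r) * lambda.
Proof.
exists ((-1) ^+ n * \prod_j z j); split.
  by rewrite normrM normrX normrN1 expr1n mul1r normr_prod big1.
apply: elem_sym_circle a_zeros => //.
- move=> j; rewrite (inj_eq (@complexI R) _ 0).
  by move/prodf_neq0: m_prod; apply.
- by move=> j; exact: conjc_real.
- by rewrite -(rmorph_sum (real_complex R)) /= (inj_eq (@complexI R) _ 0).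
Qed.
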